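(* $\mathfrak{s} \leq \text{\ss}$, where $\mathfrak{s}$ is the splitting number and $\text{\ss}$ is the subseries number.
   Context: $\mathbb{N}=\{1,2,3,\dots\}$. For $A\subseteq\mathbb{N}$, the subseries $\sum_{n\in A}a_n$ is summed in increasing order of the indices; if $A$ is finite it is a finite sum and counts as convergent. A series is conditionally convergent if it converges but not absolutely. The subseries number $\text{\ss}$ is the smallest cardinality of a family $\mathcal{A}$ of subsets of $\mathbb{N}$ such that for every conditionally convergent series $\sum_{n\in\mathbb{N}}a_n$ of real numbers there is $A\in\mathcal{A}$ such that $\sum_{n\in A}a_n$ diverges. For infinite $A,B\subseteq\mathbb{N}$, $A$ splits $B$ if both $B\cap A$ and $B\setminus A$ are infinite. The splitting number $\mathfrak{s}$ is the smallest cardinality of a family $\mathcal{A}$ of subsets of $\mathbb{N}$ such that every infinite $B\subseteq\mathbb{N}$ is split by some $A\in\mathcal{A}$. *)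

(* Defs.v *)
From HB Require Import structures.
From mathcomp Require Import all_boot all_order all_algebra.
From mathcomp Require Import all_classical all_reals all_analysis.

Set Implicit Arguments.
Unset Strict Implicit.
Unset Printing Implicit Defensive.

Import Order.TTheory GRing.Theory Num.Theory.
Import numFieldNormedType.Exports.

Local Open Scope classical_set_scope.
Local Open Scope ring_scope.
Local Open Scope card_scope.

Definition has_least_card (T : Type) (P : set (set T)) (X : set T) : Prop :=
  P X /\ forall Y, P Y -> X #<= Y.

(* "The smallest cardinality of a family X such that P X". A cardinal is
   represented by a set of that cardinality, and cardinals are compared with
   [#<=] (existence of an injection). The choice of X among the sets of least
   cardinality is irrelevant; the default value set0 is used only when no set
   satisfies P (see [least_cardP]). *)
Definition least_card (T : Type) (P : set (set T)) : set T :=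
  xget set0 (has_least_card P).

(* Cardinals are well ordered, so the minimum exists. *)
Lemma has_least_card_ex (T : Type) (P : set (set T)) :
  (exists X, P X) -> exists X, has_least_card P X.
Proof.
move=> [X0 PX0].
pose Q (S : set (set T -> T)) :=
  (forall f X, S f -> P X -> X (f X)) /\
  (forall f g X, S f -> S g -> P X -> f X = g X -> f = g).
have [F FQ Ftot|S [[Smem Sinj] Smax]] := @Zorn_bigcup _ Q.
  split=> [f X [S FS Sf] PX|f g X [S FS Sf] [S' FS' S'g] PX fg].
    by have [/(_ f X Sf PX) +] := FQ _ FS.
  have [SS'|S'S] := Ftot _ _ FS FS'.
    by have [_ /(_ f g X (SS' _ Sf) S'g PX fg)] := FQ _ FS'.
  by have [_ /(_ f g X Sf (S'S _ S'g) PX fg)] := FQ _ FS.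
have [[X [PX Xsurj]]|noX] := pselect (exists X, P X /\
    forall x, X x -> exists f, S f /\ f X = x).
  exists X; split => // Y PY.
  have xf x : exists f, X x -> S f /\ f X = x.
    have [/Xsurj[f ?]|nXx] := pselect (X x); first by exists f.
    by exists (fun=> x).
  have [h hP] := choice xf.
  have hinj : {in X &, injective (fun x => h x Y)}.
    move=> x y /set_mem/hP[Sx hx] /set_mem/hP[Sy hy] hxy.
    by rewrite -hx -hy (Sinj _ _ _ Sx Sy PY hxy).
  rewrite -(card_le_eql (inj_card_eq hinj)); apply: subset_card_le.
  by move=> _ [x /hP[Sx _] <-]; exact: Smem Sx PY.
have missed X : P X -> exists x, X x /\ forall f, S f -> f X <> x.
  move=> PX; apply: contrapT => /forallNP nx; apply: noX; exists X.
  split=> // x Xx; apply: contrapT => /forallNP nf; apply: (nx x).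
  by split=> // f Sf fx; exact: (nf f).
have exg X : exists x, P X -> X x /\ forall f, S f -> f X <> x.
  have [/missed[x ?]|nPX] := pselect (P X); first by exists x.
  by have [x _] := missed _ PX0; exists x.
have [g gP] := choice exg.
exfalso; apply: (Smax (S `|` [set g])).
  split; first by move=> f Sf; left.
  move=> /(_ g (or_intror erefl)) Sg.
  by have [_ /(_ _ Sg)] := gP _ PX0.
split=> [f X [Sf|->] PX|f f' X [Sf|->] [Sf'|->] PX ff'] //.
- exact: Smem Sf PX.
- by have [] := gP _ PX.
- exact: (Sinj _ _ X Sf Sf' PX ff').
- by have [_ /(_ _ Sf)] := gP _ PX.
- by have [_ /(_ _ Sf')] := gP _ PX; rewrite ff'.
Qed.

Lemma least_cardP (T : Type) (P : set (set T)) :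
  (exists X, P X) -> has_least_card P (least_card P).
Proof. by move=> /has_least_card_ex; exact: xgetPex. Qed.

(* The index set {1, 2, 3, ...} is relabelled in an order-preserving way as
   nat. The condition forces A and B to be infinite. *)
Definition splits (A B : set nat) : Prop :=
  infinite_set (B `&` A) /\ infinite_set (B `\` A).

Definition splitting_family (F : set (set nat)) : Prop :=
  forall B : set nat, infinite_set B -> exists2 A, F A & splits A B.

Definition splitting_number : set (set nat) := least_card splitting_family.

Definition conditionally_convergent (R : realType) (a : R^nat) : Prop :=
  cvgn (series a) /\ ~ cvgn [normed series a].

(* The N-th term is the sum of a_n over the n < N lying in A, so up to
   repetitions this is the sequence of partial sums of a over A in increasing
   order of the indices; it is eventually constant when A is finite. *)
Definition subseries (R : realType) (a : R^nat) (A : set nat) : R^nat :=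
  fun N => \sum_(0 <= n < N | n \in A) a n.

Definition subseries_family (R : realType) (F : set (set nat)) : Prop :=
  forall a : R^nat, conditionally_convergent a ->
    exists2 A, F A & ~ cvgn (subseries a A).

Definition subseries_number (R : realType) : set (set nat) :=
  least_card (@subseries_family R).

(* Main.v *)
(* Put a conditionally convergent series on the places of an infinite set B, in
   increasing order, and 0 elsewhere. If A does not split B, then A contains
   almost all or almost none of the places of B, so the subseries over A
   converges. Hence a family that meets the requirement for the subseries number
   is already a splitting family. *)
Require Import Defs.
From mathcomp Require Import all_boot all_order all_algebra.
From mathcomp Require Import all_classical all_reals all_analysis.

Import Order.TTheory GRing.Theory Num.Theory.
Import numFieldNormedType.Exports.

Local Open Scope classical_set_scope.
Local Open Scope ring_scope.
Local Open Scope card_scope.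

Lemma finite_set_nat_bounded {A : set nat} :
  finite_set A -> exists N, forall n, (N <= n)%N -> n \notin A.
Proof.
move=> /finite_seqP[s ->]; exists (\max_(i <- s) i).+1 => n ltn.
apply/negP; rewrite inE /= => ns.
by have := @leq_bigmax_seq _ s xpredT id n ns isT; rewrite leqNgt ltn.
Qed.

Lemma eq_tail_is_cvg_series (R : realType) (u v : R^nat) (N : nat) :
  (forall n, (N <= n)%N -> u n = v n) -> cvgn (series u) -> cvgn (series v).
Proof.
move=> uv; rewrite -(is_cvg_series_restrict N) -(is_cvg_series_restrict N v).
suff -> : [sequence \sum_(N <= k < n) u k]_n = [sequence \sum_(N <= k < n) v k]_n by [].
by apply/funext => n; apply: eq_big_nat => i /andP[/uv].
Qed.

(** Replacing the dropped terms by 0 turns a subseries into an ordinary series, to which tail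
    comparison applies. *)
Lemma subseriesE {R : realType} (a : R^nat) (A : set nat) :
  subseries a A = series (fun n => if n \in A then a n else 0).
Proof. by apply/funext => N; rewrite /subseries /series /= big_mkcond. Qed.

(** For [N] in [B] this is the position of [N] in the increasing enumeration of [B], counted from
    0. *)
Definition rank (B : set nat) (N : nat) : nat := \sum_(0 <= k < N) (k \in B).

Lemma rankS (B : set nat) (N : nat) : rank B N.+1 = (rank B N + (N \in B))%N.
Proof. by rewrite /rank big_nat_recr. Qed.

Lemma rank_homo (B : set nat) : {homo rank B : m n / (m <= n)%N}.
Proof.
by apply: homo_leq => //[m n p|N]; [exact: leq_trans|rewrite rankS leq_addr].
Qed.

Lemma rank_unbounded {B : set nat} (m : nat) :
  infinite_set B -> exists N, (m <= rank B N)%N.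
Proof.
move=> infB; elim: m => [|m [N mN]]; first by exists 0%N.
have [n [Nn Bn]] : exists n, (N <= n)%N /\ B n.
  apply: contrapT => /forallNP noB; apply: infB.
  apply: (sub_finite_set _ (finite_II N)) => n Bn /=.
  by rewrite ltnNge; apply/negP => Nn; apply: (noB n).
exists n.+1; rewrite rankS mem_set// addn1 ltnS.
exact: leq_trans mN (rank_homo B _ _ Nn).
Qed.

Lemma cvg_rank {B : set nat} : infinite_set B -> rank B @ \oo --> \oo.
Proof.
move=> infB; apply/cvgnyPge => m; have [N mN] := rank_unbounded m infB.
by exists N => // n /= Nn; exact: leq_trans mN (rank_homo B _ _ Nn).
Qed.

Definition spread {R : realType} (B : set nat) (u : R^nat) : R^nat :=
  fun n => if n \in B then u (rank B n) else 0.

(** Each place in [B] adds the next term of [u] and every other place adds 0, so the partial sums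
    are those of [u] with repetitions. *)
Lemma series_spread {R : realType} (B : set nat) (u : R^nat) :
  series (spread B u) = series u \o rank B.
Proof.
apply/funext; elim=> [|N IH].
  by rewrite /series /= /rank !big_geq.
rewrite seriesSr IH /= rankS /spread.
by case: ifP => _; rewrite ?addn1 ?seriesSr// addn0 addr0.
Qed.

Lemma conditionally_convergent_spread {R : realType} (B : set nat) (u : R^nat) :
  infinite_set B -> conditionally_convergent u ->
  conditionally_convergent (spread B u).
Proof.
move=> infB [cu ncu]; split.
  rewrite series_spread; apply/cvg_ex; exists (limn (series u)).
  exact: cvg_comp (cvg_rank infB) cu.
have -> : [normed series (spread B u)] = series (fun n => `|u n|) \o rank B.
  rewrite -series_spread; congr series; apply/funext => n /=.
  by rewrite /spread; case: ifP => // _; rewrite normr0.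
move=> cB; apply: ncu.
(* The partial sums of [|u|] increase, so a bound suffices. As [rank B] is unbounded, each lies
   below some partial sum of the spread series, hence below the limit of the latter. *)
have nd : nondecreasing_seq [normed series u] by apply: nondecreasing_series => n _ _ /=.
apply: nondecreasing_is_cvgn => //.
have ndB : nondecreasing_seq (series (fun n => `|u n|) \o rank B).
  by move=> m n mn; apply: nd; exact: rank_homo.
exists (limn (series (fun n => `|u n|) \o rank B)) => _ [m _ <-].
have [N mN] := rank_unbounded m infB.
exact: le_trans (nd _ _ mN) (nondecreasing_cvgn_le ndB cB N).
Qed.

(* 1 - 1 + 1/2 - 1/2 + 1/3 - 1/3 + ... : its partial sums have a closed form. *)
Definition alt_harmonic (R : realType) : R^nat :=
  fun n => (-1) ^+ n * harmonic n./2.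

Lemma series_alt_harmonic (R : realType) (n : nat) :
  series (alt_harmonic R) n = if odd n then harmonic n./2 else 0.
Proof.
elim: n => [|n IH]; first by rewrite /series /= big_geq.
rewrite seriesSr IH /alt_harmonic -signr_odd /= uphalf_half.
by case: (odd n) => /=; rewrite ?expr1 ?mulN1r ?subrr// expr0 mul1r add0r.
Qed.

Lemma conditionally_convergent_alt_harmonic (R : realType) :
  conditionally_convergent (alt_harmonic R).
Proof.
split.
  apply/cvg_ex; exists 0.
  have half_cvg : (fun n => n./2) @ \oo --> \oo.
    apply/cvgnyPge => m; exists m.*2 => // n /= mn.
    by rewrite -(doubleK m) half_leq.
  have hcvg : (fun n => harmonic n./2 : R) @ \oo --> 0.
    exact: cvg_comp half_cvg cvg_harmonic.
  (* By the closed form, the partial sums lie between 0 and [harmonic n./2]. *)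
  apply: (squeeze_cvgr _ (cvg_cst 0) hcvg).
  near=> n; rewrite series_alt_harmonic.
  by case: ifP => _; rewrite ?lexx ?harmonic_ge0.
have abs_alt n : `|alt_harmonic R n| = harmonic n./2.
  rewrite /alt_harmonic normrM normrX normrN1 expr1n mul1r.
  by rewrite ger0_norm ?harmonic_ge0.
(* Since [n./2 <= n], the absolute values dominate the harmonic series term by term. *)
apply: contra_not (@dvg_harmonic R); apply: series_le_cvg => n //=.
by rewrite abs_alt /= lef_pV2 ?posrE// ler_nat ltnS -divn2 leq_div.
Unshelve. all: by end_near. Qed.

Lemma subseries_family_splitting (R : realType) (F : set (set nat)) :
  subseries_family R F -> splitting_family F.
Proof.
move=> sF B infB.
have ccB := conditionally_convergent_spread _ _ infB
  (conditionally_convergent_alt_harmonic R).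
have [A FA dA] := sF _ ccB; exists A => //; rewrite subseriesE in dA.
split=> finB; apply: dA; have [N Nfin] := finite_set_nat_bounded finB.
  (* [B] meets [A] in a finite set: from [N] on, [A] keeps only zeros. *)
  apply: (eq_tail_is_cvg_series _ (fun=> 0) _ N).
    move=> n /Nfin; rewrite in_setI /spread.
    by case: (n \in B) => /=; case: (n \in A).
  have -> : series (fun=> 0 : R) = cst 0.
    by apply/funext => n; rewrite /series /= big1.
  exact: is_cvg_cst.
(* Only finitely many places of [B] lie outside [A]: from [N] on, [A] drops only zeros. *)
apply: (eq_tail_is_cvg_series _ _ _ N _ ccB.1) => n /Nfin.
by rewrite in_setD /spread; case: (n \in A) => //=; case: (n \in B).
Qed.

(** If the sum over the nonnegative terms converged, then so would the absolute series, because
    [|x| = 2 max(x, 0) - x]. *)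
Lemma subseries_family_setT (R : realType) : subseries_family R setT.
Proof.
move=> a [ca nca]; exists [set n | 0 <= a n] => // cp; apply: nca.
rewrite subseriesE in cp.
set p := (X in series X) in cp.
have -> : [normed series a] = series p + series p - series a.
  apply/funext => N; rewrite /series /= !fctE -big_split -sumrB /=.
  apply: eq_bigr => n _; rewrite /p mem_setE.
  case: ifPn => [a0|]; first by rewrite ger0_norm// addrK.
  by rewrite -ltNge => /ltr0_norm ->; rewrite addr0 sub0r.
by apply: is_cvgB => //; exact: is_cvgD.
Qed.

Theorem theorem7 (R : realType) : splitting_number #<= subseries_number R.
Proof.
have sT := subseries_family_setT R.
(* The full power set witnesses that both kinds of families exist, so neither minimum is the default
   [set0]. *)
have [sR _] := least_cardP (ex_intro _ _ sT).
have [_ minS] := least_cardP (ex_intro _ _ (subseries_family_splitting R _ sT)).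
by apply: minS; exact: subseries_family_splitting sR.
Qed.
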